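(* Let $M\ge2$ be an integer, $A>1$ and $q>0$. We have, for any integer $n$ such that $\log M\le 16(\min(1,A-1))^2 n$, $$\sup_{f_1,\dots,f_M\in\mathcal{F}_K(A)}\ \inf_{\hat f_n}\ \sup_{f\in\mathcal{F}(A)}\left[\mathbb{E}_f\left[(K(f|\hat f_n))^q\right]-\min_{j=1,\dots,M}(K(f|f_j))^q\right]\ge c\left(\frac{\log M}{n}\right)^{q},$$ and $$\sup_{f_1,\dots,f_M\in\mathcal{F}_K(A)}\ \inf_{\hat f_n}\ \sup_{f\in\mathcal{F}(A)}\left[\mathbb{E}_f\left[(K(\hat f_n|f))^q\right]-\min_{j=1,\dots,M}(K(f_j|f))^q\right]\ge c\left(\frac{\log M}{n}\right)^{q},$$ where $c$ is a positive constant which depends only on $A$.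
   Context: Setting: $X_1,\dots,X_n$ are i.i.d. observations in $\mathbb{R}^d$ drawn from an unknown probability with density $f$ with respect to the Lebesgue measure on $\mathbb{R}^d$; $\mathbb{E}_f$ is the expectation when the true density is $f$. Both $\mathcal{F}(A)$ and $\mathcal{F}_K(A)$ denote the set of densities on $\mathbb{R}^d$ bounded by $A$. The infimum $\inf_{\hat f_n}$ is over all estimators based on a sample of size $n$. Kullback-Leibler divergence: for densities $f,g$ with associated probability distributions $P_f,P_g$, $K(f|g)=\int_{\mathbb{R}^d}\log(f/g)\,f\,dx$ if $P_f\ll P_g$, and $K(f|g)=+\infty$ otherwise. *)

(* Defs.v *)
From HB Require Import structures.
From mathcomp Require Import all_boot all_order all_algebra.
From mathcomp Require Import all_classical all_reals all_analysis measurable_realfun.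

Set Implicit Arguments.
Unset Strict Implicit.
Unset Printing Implicit Defensive.

Import Order.TTheory GRing.Theory Num.Theory.

Local Open Scope classical_set_scope.
Local Open Scope ring_scope.
Local Open Scope ereal_scope.

Section tuple_measure.
Context d (T : measurableType d) (R : realType).

Definition tuple_cons n (x : T * n.-tuple T) : n.+1.-tuple T :=
  [tuple of x.1 :: x.2].

Definition tuple_uncons n (t : n.+1.-tuple T) : T * n.-tuple T :=
  (thead t, [tuple of behead t]).

Lemma tuple_consK n : cancel (@tuple_cons n) (@tuple_uncons n).
Proof. by move=> [x t]; congr pair; rewrite ?theadE//; apply/val_inj. Qed.

Lemma measurable_tuple_cons n : measurable_fun [set: _] (@tuple_cons n).
Proof. exact: (measurable_cons (f := fst) (g := snd)). Qed.

Lemma measurable_tuple_uncons n : measurable_fun [set: _] (@tuple_uncons n).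
Proof.
by apply/measurable_fun_pair; [exact: measurable_tnth|exact: measurable_behead].
Qed.

Section tuple_measure_step.
Variables (mu : {sigma_finite_measure set T -> \bar R}) (n : nat).
Variable nu : {sigma_finite_measure set (n.-tuple T) -> \bar R}.

Definition tuple_measure_step : set (n.+1.-tuple T) -> \bar R :=
  pushforward (mu \x nu) (@tuple_cons n).

Let step0 : tuple_measure_step set0 = 0.
Proof. by rewrite /tuple_measure_step /pushforward preimage_set0 measure0. Qed.

Let step_ge0 A : 0 <= tuple_measure_step A.
Proof. exact: (measure_ge0 (mu \x nu)). Qed.

Let step_sigma_additive : semi_sigma_additive tuple_measure_step.
Proof.
move=> F mF tF mUF; rewrite /tuple_measure_step /pushforward preimage_bigcup.
have mc := @measurable_tuple_cons n.
apply: measure_semi_sigma_additive.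
- by move=> k; rewrite -[X in measurable X]setTI; exact: mc.
- apply/trivIsetP => /= i j _ _ ij; rewrite -preimage_setI.
  by move/trivIsetP : tF => /(_ _ _ _ _ ij) ->//; rewrite preimage_set0.
- by rewrite -preimage_bigcup -[X in measurable X]setTI; exact: mc.
Qed.

HB.instance Definition _ := isMeasure.Build _ _ _ tuple_measure_step
  step0 step_ge0 step_sigma_additive.

Let step_sigma_finite : sigma_finite setT tuple_measure_step.
Proof.
have /sigma_finiteP[F [TF ndF Foo]] := sigma_finiteT mu.
have /sigma_finiteP[G [TG ndG Goo]] := sigma_finiteT nu.
exists (fun k => @tuple_uncons n @^-1` (F k `*` G k)).
  rewrite -preimage_bigcup (_ : \bigcup_k _ = setT) ?preimage_setT//.
  apply/seteqP; split => // -[x y] _.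
  have [i _ Fx] : (\bigcup_k F k) x by rewrite -TF.
  have [j _ Gy] : (\bigcup_k G k) y by rewrite -TG.
  exists (maxn i j) => //; split => /=.
  - by move: x Fx; exact/subsetPset/ndF/leq_maxl.
  - by move: y Gy; exact/subsetPset/ndG/leq_maxr.
move=> k; have [mF Fk] := Foo k; have [mG Gk] := Goo k; split.
  rewrite -[X in measurable X]setTI; apply: measurable_tuple_uncons => //.
  exact: measurableX.
rewrite /tuple_measure_step /pushforward -comp_preimage.
rewrite (_ : _ \o _ = id); last by apply/funext => x; exact: tuple_consK.
by rewrite preimage_id product_measure1E// lte_mul_pinfty// ge0_fin_numE.
Qed.

HB.instance Definition _ := Measure_isSigmaFinite.Build _ _ _
  tuple_measure_step step_sigma_finite.

End tuple_measure_step.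

(* The n-fold product of mu, on n.-tuple T; see tuple_measure_box. *)
Fixpoint tuple_measure (mu : {sigma_finite_measure set T -> \bar R}) (n : nat) :
    {sigma_finite_measure set (n.-tuple T) -> \bar R} :=
  match n with
  | 0%N => \d_[tuple]
  | n'.+1 => tuple_measure_step mu (tuple_measure mu n')
  end.

Lemma measurable_tuple_box n (A : 'I_n -> set T) :
  (forall i, measurable (A i)) ->
  measurable [set t : n.-tuple T | forall i, A i (tnth t i)].
Proof.
move=> mA.
rewrite (_ : [set _ | _] = \bigcap_(i in [set: 'I_n]) ((@tnth _ T ^~ i) @^-1` A i)).
  apply: fin_bigcap_measurable => // i _.
  by rewrite -[X in measurable X]setTI; exact: measurable_tnth.
by apply/seteqP; split => t /= h i; [move=> _|]; exact: h.
Qed.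

Lemma tuple_measure_box (mu : {sigma_finite_measure set T -> \bar R}) n
    (A : 'I_n -> set T) : (forall i, measurable (A i)) ->
  tuple_measure mu n [set t | forall i, A i (tnth t i)] =
  \prod_(i < n) mu (A i).
Proof.
elim: n A => [|n IH] A mA.
  by rewrite big_ord0/= diracE mem_set// => -[].
rewrite big_ord_recl -IH//.
rewrite -(@product_measure1E _ _ _ _ _ mu (tuple_measure mu n))//; last first.
  exact: (measurable_tuple_box (A := fun i => A (lift ord0 i))).
rewrite /= /tuple_measure_step /pushforward; congr (product_measure1 _ _ _).
apply/seteqP; split => [[x t]/= h|[x t]/= [h0 h] i].
  split; first by have := h ord0; rewrite tnth0.
  by move=> i; have := h (lift ord0 i); rewrite tnthS.
by case: (unliftP ord0 i) => [j ->|->]; rewrite ?tnthS ?tnth0.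
Qed.

End tuple_measure.

Section densities.
Context (R : realType) (d : nat).

(* R^d with its Borel sigma-algebra (the product one) *)
Definition Rd : Type := d.-tuple (measurableTypeR R).
HB.instance Definition _ := Measurable.on Rd.

Definition lebesgue_Rd : {sigma_finite_measure set Rd -> \bar R} :=
  tuple_measure lebesgue_measure d.

Record density := Density {
  density_fun :> Rd -> R ;
  measurable_density : measurable_fun [set: Rd] density_fun ;
  density_ge0 : forall x, (0 <= density_fun x)%R ;
  integral_density : \int[lebesgue_Rd]_x (density_fun x)%:E = 1 }.

Definition bounded_density (A : R) : set density :=
  [set f | forall x, (f x <= A)%R].

Section density_prob.
Variable f : density.

Definition density_prob : set Rd -> \bar R :=
  fun B => \int[lebesgue_Rd]_(x in B) (f x)%:E.

Let mf : measurable_fun [set: Rd] (EFin \o f).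
Proof. by apply/measurable_EFinP; exact: measurable_density. Qed.

Let prob0 : density_prob set0 = 0.
Proof. exact: integral_set0. Qed.

Let prob_ge0 B : 0 <= density_prob B.
Proof. by apply: integral_ge0 => x _; rewrite lee_fin density_ge0. Qed.

Let prob_sigma_additive : semi_sigma_additive density_prob.
Proof.
move=> F mF tF mUF; rewrite /density_prob ge0_integral_bigcup//=.
- by apply: is_cvg_ereal_nneg_natsum => // n _; exact: prob_ge0.
- exact: measurable_funTS.
- by move=> x _; rewrite lee_fin density_ge0.
Qed.

HB.instance Definition _ := isMeasure.Build _ _ _ density_prob
  prob0 prob_ge0 prob_sigma_additive.

Let prob_setT : density_prob [set: Rd] = 1.
Proof. exact: integral_density. Qed.

HB.instance Definition _ :=
  Measure_isProbability.Build _ _ _ density_prob prob_setT.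

End density_prob.

(* Since ln 0 = 0 and y / 0 = 0, the integrand is 0 where f vanishes, as usual,
   and also where g vanishes but not f, a null set under absolute continuity.
   Its negative part is bounded by g, so that the integral is well defined. *)
Definition KL (f g : density) : \bar R :=
  if `[< density_prob f `<< density_prob g >]
  then \int[lebesgue_Rd]_x (ln (f x / g x) * f x)%:E
  else +oo.

Definition sample_law (n : nat) (f : density) :
    {sigma_finite_measure set (n.-tuple Rd) -> \bar R} :=
  tuple_measure (density_prob f) n.

(* A measurable map from samples to densities; measurability is joint in the
   sample and the point, so that losses such as KL f (fhat x) are measurable. *)
Record estimator (n : nat) := Estimator {
  estimate :> n.-tuple Rd -> density ;
  measurable_estimate :
    measurable_fun [set: n.-tuple Rd * Rd] (fun z => estimate z.1 z.2) }.

End densities.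

(* Main.v *)
Require Import Defs.
From HB Require Import structures.
From mathcomp Require Import all_boot all_order all_algebra.
From mathcomp Require Import all_classical all_reals all_analysis measurable_realfun.
From mathcomp Require Import ring lra.

(* All densities used are constant on unit cells [k, k+1[ x [0, 1[^(d-1).

   First bound. Let f_(j,k) = (1 - eps) 1_(C_0) + eps 1_(C_(j,k)) for j < M,
   k < B and eps = 1 / (2n), and let f_j be the average of the f_(j,k) over k, so
   that K(f_(j,k) | f_j) = eps log B. With probability at least 1/2 the sample
   stays in C_0 and says nothing about (j, k). For c = B sqrt M, at most c of the
   M B spikes receive more than a fraction 1 / c of the mass that the estimator
   leaves outside C_0; on every other spike its loss is at least eps log c. For
   B = 1 this settles the bounded exponents q. The constant must not depend on q,
   and for large q the choice B = M^2 makes (eps log c)^q / 8 exceed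
   (eps log B)^q by at least a multiple of (log M / n)^q.

   Second bound. The supremum is infinite. Let f = (g + 1_(D_b)) / 2, where b is
   one of two values and g is uniform on a set T of cells, and let every f_j be
   one of the two 1_(D_b), so that min_j K(f_j | f) <= log 2. Unless its risk is
   infinite for some such f, the estimator almost surely has no mass outside
   D_b and T, for both b and all T containing the sample, hence it lives on the at
   most n cells that were observed. If g is uniform on N cells, these have f-mass
   at most n / (2N), so the loss is at least log (2N / n) with probability at
   least 2^-n. *)

Set Implicit Arguments.
Unset Strict Implicit.

Import Order.TTheory GRing.Theory Num.Theory.

Local Open Scope classical_set_scope.
Local Open Scope ring_scope.
Local Open Scope ereal_scope.

(** * Lower bounds on integrals and comparison of product measures *)

Section general_measure.
Context d (T : measurableType d) (R : realType).
Implicit Types mu : {measure set T -> \bar R}.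

(** Monotonicity needs no measurability of [f] here, because the integral of a nonnegative function
    is the supremum over the simple functions below it. It serves to bound risks from below on an
    event of samples. *)
Lemma ge0_cst_le_integral mu (E : set T) (v : R) (f : T -> \bar R) :
  measurable E -> (0 <= v)%R -> (forall x, 0 <= f x) ->
  (forall x, E x -> v%:E <= f x) -> v%:E * mu E <= \int[mu]_x f x.
Proof.
move=> mE v0 f0 vf; rewrite -integral_cst// integral_mkcond.
rewrite !ge0_integralTE//; last first.
  by move=> x; rewrite patchE; case: ifP => //; rewrite lee_fin.
apply: ereal_sup_le => //= _ [h /= hv <-]; exists h => //= x.
apply: le_trans (hv x) _; rewrite patchE.
by case: ifPn => //; rewrite inE; exact: vf.
Qed.

Lemma ge0_integral_eq_pinfty mu (E : set T) (f : T -> \bar R) :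
  measurable E -> 0 < mu E -> (forall x, 0 <= f x) ->
  (forall x, E x -> f x = +oo) -> \int[mu]_x f x = +oo.
Proof.
move=> mE E0 f0 fE; apply/eqP; rewrite -leye_eq.
apply: (@le_trans _ _ (\int[mu]_(x in E) cst +oo x)).
  by rewrite integral_cst// gt0_mulye.
rewrite integral_mkcond !ge0_integralTE//; last first.
  by move=> x; rewrite patchE; case: ifPn => // _; rewrite leey.
apply: ereal_sup_le => //= _ [h /= hv <-]; exists h => //= x.
apply: le_trans (hv x) _; rewrite patchE.
by case: ifPn => //; rewrite inE => /fE ->.
Qed.

End general_measure.

Section tuple_measure_le.
Context d (T : measurableType d) (R : realType).

(** Induction on [n], slicing [Z] along the first coordinate. This transfers events from one sample
    law to another: once with [D] the whole space, once with [D] a union of cells that the sample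
    does not leave. *)
Lemma tuple_measure_le (mu nu : {sigma_finite_measure set T -> \bar R})
    (D : set T) (c : R) : measurable D -> (0 <= c)%R ->
  (forall B, measurable B -> B `<=` D -> c%:E * mu B <= nu B) ->
  forall n (Z : set (n.-tuple T)), measurable Z ->
    Z `<=` [set t | forall i, D (tnth t i)] ->
    (c ^+ n)%:E * tuple_measure mu n Z <= tuple_measure nu n Z.
Proof.
move=> mD c0 munu; elim=> [|n IH] Z mZ ZD.
  by rewrite expr0 mul1e.
rewrite /= /tuple_measure_step /pushforward /product_measure1.
set W := (_ @^-1` Z).
have mW : measurable W.
  by rewrite -[W]setTI; exact: measurable_tuple_cons.
pose g x := tuple_measure nu n (xsection W x).
have mg : measurable_fun [set: T] g by exact: measurable_fun_xsection.
have g0 x : 0 <= g x by exact: measure_ge0.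
have mx x : measurable (xsection W x) by exact: measurable_xsection.
have sx x : xsection W x `<=` [set t | forall i, D (tnth t i)].
  move=> t; rewrite xsectionE /W /= => /ZD /= h i.
  by have := h (lift ord0 i); rewrite tnthS.
have gD x : ~ D x -> g x = 0.
  move=> nDx; rewrite /g (_ : xsection W x = set0) ?measure0//.
  apply/seteqP; split => // t; rewrite xsectionE /W /= => /ZD /=.
  by move=> /(_ ord0); rewrite tnth0.
rewrite exprSr EFinM -muleA.
have mh : measurable_fun [set: T] (tuple_measure mu n \o xsection W).
  exact: measurable_fun_xsection.
rewrite (muleC c%:E) muleA -ge0_integralZl//; last first.
  by rewrite lee_fin exprn_ge0.
rewrite muleC.
apply: (@le_trans _ _ (c%:E * \int[mu]_x g x)).
  apply: lee_wpmul2l => //; apply: ge0_le_integral => //.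
  - by move=> x _; rewrite mule_ge0// lee_fin exprn_ge0.
  - exact: measurable_funeM.
  - by move=> x _; exact: IH.
(* The domination is known inside [D] only. Adding to [nu] the part of [c * mu] outside [D] makes it
   valid on every measurable set, and the added part contributes nothing since [g] vanishes outside
   [D]. *)
have muD : forall S, measurable S ->
    mscale (NngNum c0) mu S <=
    measure_add nu (mscale (NngNum c0) (mrestr mu (measurableC mD))) S.
  move=> S mS; rewrite measure_addE /mscale/= /mrestr.
  rewrite (measureDI mu mS mD) addeC ge0_muleDr//.
  apply: leeD; last by rewrite setDE.

  apply: le_trans (munu _ _ _) _ => //; first exact: measurableI.
  by apply: le_measure; rewrite ?inE//; exact: measurableI.
rewrite -[c]/((NngNum c0)%:num)%R -ge0_integral_mscale//.
apply: le_trans (ge0_le_measure_integral muD measurableT g0 mg) _.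
rewrite ge0_integral_measure_add// [X in _ + X](_ : _ = 0) ?adde0//.
rewrite ge0_integral_mscale// (@ge0_negligible_integral _ _ _ _ _ D)//.
  by rewrite setTD integral0_eq ?mule0// => x /= /gD.
by transitivity (mu (D `&` ~` D)) => //; rewrite setICr measure0.
Qed.
End tuple_measure_le.

(** * Kullback-Leibler divergence *)

Lemma ae_le_integral d (T : measurableType d) (R : realType)
    (mu : {measure set T -> \bar R}) (f g : T -> \bar R) :
  measurable_fun [set: T] f -> measurable_fun [set: T] g ->
  {ae mu, forall x, f x <= g x} -> \int[mu]_x f x <= \int[mu]_x g x.
Proof.
move=> mf mg fg; rewrite integralE [leRHS]integralE; apply: leeB.
  apply: ae_ge0_le_integral => //; [exact: measurable_funepos..|].
  by apply: filterS fg => x fgx _;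
  rewrite funepos.unlock ge_max !le_max fgx lexx orbT.
apply: ae_ge0_le_integral => //; [exact: measurable_funeneg..|].
by apply: filterS fg => x fgx _;
rewrite funeneg.unlock ge_max !le_max leeN2 fgx lexx orbT.
Qed.

Section densities.
Context (R : realType) (d : nat).
Implicit Types f g h : density R d.
Local Notation lambda := (lebesgue_Rd R d).

Lemma measurable_EFin_density f : measurable_fun [set: Rd R d] (EFin \o f).
Proof. by apply/measurable_EFinP; exact: measurable_density. Qed.

Lemma density_prob_fin_num f (B : set (Rd R d)) :
  measurable B -> density_prob f B \is a fin_num.
Proof. exact: fin_num_measure. Qed.

Lemma density_prob_le f g (c : R) (B : set (Rd R d)) : measurable B ->
  (0 <= c)%R -> (forall x, B x -> (c * f x <= g x)%R) ->
  c%:E * density_prob f B <= density_prob g B.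
Proof.
move=> mB c0 fg.
have mf := measurable_funTS (D := B) (measurable_EFin_density f).
have mg := measurable_funTS (D := B) (measurable_EFin_density g).
rewrite /density_prob /= -ge0_integralZl//; last first.
  by move=> x _; rewrite lee_fin density_ge0.
apply: ge0_le_integral => //.
- by move=> x _; rewrite mule_ge0// lee_fin density_ge0.
- exact: measurable_funeM.
Qed.

Lemma integral_indic_density f (B : set (Rd R d)) : measurable B ->
  \int[lambda]_x (\1_B x * f x)%:E = density_prob f B.
Proof.
move=> mB; rewrite /density_prob/= [RHS]integral_mkcond.
apply: eq_integral => x _; rewrite patchE indicE.
by case: ifPn => _; rewrite ?mul1r ?mul0r.
Qed.

Lemma integrable_indic_density f (B : set (Rd R d)) : measurable B ->
  lambda.-integrable [set: Rd R d] (fun x => (\1_B x * f x)%:E).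
Proof.
move=> mB; apply/integrableP; split.
  apply/measurable_EFinP/measurable_funM => //; exact: measurable_density.
under eq_integral.
  move=> x _; rewrite abse_EFin ger0_norm ?mulr_ge0 ?density_ge0//.
  over.
by rewrite integral_indic_density// -ge0_fin_numE// density_prob_fin_num.
Qed.

Lemma measurable_KL_integrand f g :
  measurable_fun [set: Rd R d] (fun x => (ln (f x / g x) * f x)%:E).
Proof.
apply/measurable_EFinP/measurable_funM; last exact: measurable_density.
apply: measurableT_comp => //.
apply: measurable_funM; first exact: measurable_density.
rewrite (_ : (fun x => (g x)^-1%R) = (@powR R ^~ (-1)%R) \o g); last first.
  by apply/funext => x /=; rewrite powR_inv1// density_ge0.
by apply: measurableT_comp; [exact: measurable_powR|exact: measurable_density].
Qed.

Lemma density_ae_eq0 f (B : set (Rd R d)) : measurable B ->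
  density_prob f B = 0 -> {ae lambda, forall x, B x -> f x = 0%R}.
Proof.
move=> mB fB.
have mf := measurable_funTS (D := B) (measurable_EFin_density f).
have : \int[lambda]_(x in B) `|(EFin \o f) x| = 0.
  rewrite -[RHS]fB; apply: eq_integral => x _.
  by rewrite /= ger0_norm// density_ge0.
move/(ae_eq_integral_abs lambda mB mf).1.
by apply: filterS => x /= h /h [].
Qed.

(* [ln t >= 1 - 1 / t] at [t = f / (c * g)] *)
Lemma ln_div_ge (u v c : R) : (0 < u -> 0 < v -> 0 < c ->
  u * ln c + u - c * v <= ln (u / v) * u)%R.
Proof.
move=> u0 v0 c0.
have t0 : (0 < c * v / u)%R by rewrite divr_gt0// mulr_gt0.
have := @le_ln1Dx R (c * v / u - 1)%R.
rewrite (_ : 1 + (_ - 1) = c * v / u)%R; last by rewrite addrC subrK.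
rewrite ltrBDl subrr => /(_ t0).
rewrite ln_div ?posrE ?mulr_gt0// lnM ?posrE// ln_div ?posrE//.
rewrite -(ler_pM2r u0) (mulrBl u _ 1%R) divfK ?gt_eqF// mul1r.
by lra.
Qed.

(** This integrates [ln_div_ge] with constant [c] on [U] and 1 on [V]. It is the variational lower
    bound for the divergence with test function [c] on [U], 1 on [V] and 0 elsewhere. *)
Lemma KL_ge f g (U V : set (Rd R d)) (c : R) :
  measurable U -> measurable V -> U `&` V = set0 -> (0 < c)%R ->
  density_prob f (~` (U `|` V)) = 0 ->
  (ln c)%:E * density_prob f U + 1
    - (c%:E * density_prob g U + density_prob g V) <= KL f g.
Proof.
move=> mU mV UV c0 fUV; rewrite /KL; case: ifPn => [/asboolP fg|_]; last first.
  by rewrite leey.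
have mf := measurable_density f; have mg := measurable_density g.
(* By absolute continuity [f] vanishes almost everywhere on [Z], so the default value of [f / g] at
   [g = 0] does not matter where [f > 0]. *)
pose Z := [set x | g x = 0%R].
have mZ : measurable Z.
  by rewrite -[Z]setTI; exact: (mg measurableT [set 0%R] (measurable_set1 _)).
have fZ : density_prob f Z = 0.
  apply: (fg Z) => //; apply/measure0_null_setP => //.
  by apply: integral0_eq => x /= ->.
have ae1 := density_ae_eq0 (measurableC (measurableU _ _ mU mV)) fUV.
have ae2 := density_ae_eq0 mZ fZ.
have mUV : measurable (~` (U `|` V)) by apply/measurableC/measurableU.
have := integrable_indic_density f mU => ifU.
have := integrable_indic_density f measurableT => ifT.
have := integrable_indic_density g mU => igU.
have := integrable_indic_density g mV => igV.
rewrite -(integral_indic_density f mU) -(integral_density f).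
rewrite -(integral_indic_density g mU) -(integral_indic_density g mV).
rewrite -!integralZl// (_ : \int[lambda]_x (f x)%:E =
  \int[lambda]_x (\1_[set: Rd R d] x * f x)%:E); last first.
  by apply: eq_integral => x _; rewrite indicE in_setT mul1r.
have i1 := integrableZl measurableT (ln c) ifU.
have i2 := integrableZl measurableT c igU.
rewrite -!integralD// -integralB//; try exact: integrableD.
apply: ae_le_integral.
- apply: (measurable_int lambda); apply: integrableB => //; exact: integrableD.
- exact: measurable_KL_integrand.
apply: filterS2 ae1 ae2 => x h1 h2.
rewrite -!EFinM -!EFinD lee_fin !indicE in_setT mul1r.
have := density_ge0 f x; have := density_ge0 g x.
rewrite le_eqVlt => gx0; rewrite le_eqVlt => /predU1P[fx0|fx0].
  rewrite -fx0 !mulr0 add0r sub0r oppr_le0 addr_ge0 ?mulr_ge0 ?density_ge0//.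
  exact: ltW.
have {gx0} gx0 : (0 < g x)%R.
  case/predU1P: gx0 => [/esym/h2 f0|//].
  by move: fx0; rewrite f0 ltxx.
have [Ux|Ux] := boolP (x \in U).
  have -> : (x \in V) = false.
    apply/negbTE/negP; rewrite !inE in Ux * => Vx.
    by have : (U `&` V) x by []; rewrite UV.
  have := ln_div_ge fx0 gx0 c0; rewrite /=; lra.
have [Vx|Vx] := boolP (x \in V).
  have := ln_div_ge fx0 gx0 ltr01; rewrite ln1 /=; lra.
move: fx0; rewrite h1 ?ltxx//.
by rewrite !notin_setE in Ux Vx; case.
Qed.

(** The log-ratio is at most [ln c] on [U] and at most 0 elsewhere. The pointwise bound also yields
    absolute continuity, so the infinite branch of [KL] is excluded. *)
Lemma KL_le f g (U : set (Rd R d)) (c : R) : measurable U -> (1 <= c)%R ->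
  (forall x, f x <= (if x \in U then c else 1) * g x)%R ->
  KL f g <= (ln c)%:E * density_prob f U.
Proof.
move=> mU c1 fg; rewrite /KL.
case: ifPn => [/asboolP _|/asboolP nfg]; last first.
  case: nfg; apply/null_content_dominatesP => B mB gB.
  have c0 : (0 < c)%R by exact: lt_le_trans c1.
  apply/eqP; rewrite -measure_le0.
  have : (c^-1)%:E * density_prob f B <= density_prob g B.
    apply: density_prob_le => // [|x _]; first by rewrite invr_ge0 ltW.
    rewrite ler_pdivrMl//; apply: le_trans (fg x) _.
    by rewrite ler_wpM2r ?density_ge0//; case: ifP.
  by rewrite [X in _ <= X]gB pmule_rle0// lte_fin invr_gt0.
rewrite -integral_indic_density// -integralZl//; last first.
  exact: integrable_indic_density.
apply: ae_le_integral.
- exact: measurable_KL_integrand.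
- apply: (measurable_int lambda); apply: integrableZl => //.
  exact: integrable_indic_density.
apply: aeW => x; rewrite -EFinM lee_fin mulrA indicE.
have := density_ge0 f x; rewrite le_eqVlt => /predU1P[<-|fx0].
  by rewrite !mulr0.
rewrite ler_pM2r//.
have := lt_le_trans fx0 (fg x).
have := fg x.
case: ifPn => _ ; rewrite ?mul1r ?mulr1 ?mulr0 => fgx gx0.
  have {}gx0 : (0 < g x)%R.
    by move: gx0; rewrite pmulr_rgt0// (lt_le_trans _ c1).
  by rewrite ler_ln ?posrE ?divr_gt0// ?(lt_le_trans _ c1)// ler_pdivrMr.
by apply: ln_le0; rewrite ler_pdivrMr// mul1r.
Qed.

Lemma KL_ge0 f g : 0 <= KL f g.
Proof.
have := @KL_ge f g set0 setT 1%R measurable0 measurableT (set0I _) ltr01.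
rewrite set0U setCT !measure0 mule0 !mule0 !add0e => /(_ erefl).
by rewrite probability_setT subee.
Qed.

End densities.

(** * Step densities *)

Section estimates.
Context (R : realType) (d : nat).
Implicit Types f g h : density R d.

(** Tonelli: a partial integral of a function that is jointly measurable in the sample and the
    point. *)
Lemma measurable_estimate_prob n (fhat : estimator R d n) (B : set (Rd R d)) :
  measurable B ->
  measurable_fun [set: n.-tuple (Rd R d)] (fun x => density_prob (fhat x) B).
Proof.
move=> mB.
pose F (z : n.-tuple (Rd R d) * Rd R d) := (\1_B z.2 * fhat z.1 z.2)%:E.
rewrite (_ : (fun x => _) = fubini_F (lebesgue_Rd R d) F); last first.
  by apply/funext => x; rewrite -integral_indic_density.
apply: measurable_fun_fubini_tonelli_F => /=.
  apply/measurable_EFinP/measurable_funM; last exact: measurable_estimate.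
  by apply: measurableT_comp => //; exact: measurable_indic.
by move=> z; rewrite lee_fin mulr_ge0 ?density_ge0.
Qed.

End estimates.

Section cells.
Context (R : realType) (d : nat).

Definition cell_side (k : nat) (i : 'I_d) : set (measurableTypeR R) :=
  if val i == 0%N then `[(k%:R : R)%R, k.+1%:R%R[%classic
  else `[(0 : R)%R, 1%R[%classic.

Definition cell (k : nat) : set (Rd R d) :=
  [set x | forall i, cell_side k i (tnth x i)].

Let measurable_cell_side k i : measurable (cell_side k i).
Proof. by rewrite /cell_side; case: ifP. Qed.

Lemma measurable_cell k : measurable (cell k).
Proof. exact: (measurable_tuple_box (A := cell_side k)). Qed.

Lemma lebesgue_cell k : lebesgue_Rd R d (cell k) = 1.
Proof.
rewrite /lebesgue_Rd (tuple_measure_box _ (A := cell_side k))//.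
apply: big1 => i _; rewrite /cell_side; case: ifP => _.
  rewrite /= lebesgue_measure_itv/= lte_fin ltr_nat ltnSn.
  by rewrite -EFinB -natrB// subSnn.
by rewrite /= lebesgue_measure_itv/= lte_fin ltr01 oppr0 adde0.
Qed.

Lemma cell_inj (d_gt0 : (0 < d)%N) j k x : cell j x -> cell k x -> j = k.
Proof.
move=> /(_ (Ordinal d_gt0)) + /(_ (Ordinal d_gt0)).
rewrite /cell_side/= !in_itv/= => /andP[ja ja1] /andP[ka ka1].
have := le_lt_trans ja ka1; have := le_lt_trans ka ja1.
by rewrite !ltr_nat !ltnS => ? ?; apply/eqP; rewrite eqn_leq; apply/andP.
Qed.

Context (I : finType).
Implicit Types (J K : {set I}) (w : I -> R).

(** Any finite index type is laid out on the unit cells through [enum_rank], so that weights on [I]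
    turn into densities. *)
Definition cells J : set (Rd R d) :=
  [set x | exists2 i, i \in J & cell (enum_rank i) x].

Lemma measurable_cells J : measurable (cells J).
Proof.
rewrite (_ : cells J = \big[setU/set0]_(i in J) cell (enum_rank i)).
  by apply: bigsetU_measurable => i _; exact: measurable_cell.
by rewrite -bigcup_pred.
Qed.

Lemma cells_setI (d_gt0 : (0 < d)%N) J K :
  {in J, forall i, i \notin K} -> cells J `&` cells K = set0.
Proof.
move=> JK; apply/seteqP; split => // x [[i iJ ix] [j jK jx]].
have ij : i = j by apply/enum_rank_inj/val_inj; exact: cell_inj ix jx.
by have := JK _ iJ; rewrite ij jK.
Qed.

Definition step_fun w (x : Rd R d) : R :=
  \sum_i w i * \1_(cell (enum_rank i)) x.

Lemma step_fun_out w x : ~ cells [set: I] x -> step_fun w x = 0%R.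
Proof.
move=> nx; apply: big1 => i _; rewrite indicE memNset ?mulr0// => ix.
by apply: nx; exists i => //; rewrite inE.
Qed.

Lemma step_fun_in (d_gt0 : (0 < d)%N) w i x :
  cell (enum_rank i) x -> step_fun w x = w i.
Proof.
move=> ix; rewrite /step_fun (bigD1 i)//= indicE mem_set// mulr1.
rewrite big1 ?addr0// => j ji; rewrite indicE memNset ?mulr0// => jx.
by move: ji; rewrite (enum_rank_inj (val_inj (cell_inj d_gt0 jx ix))) eqxx.
Qed.

Lemma measurable_step_fun w : measurable_fun [set: Rd R d] (step_fun w).
Proof.
apply: measurable_sum => i; apply: measurable_funM => //.
by apply: measurable_indic; exact: measurable_cell.
Qed.

Lemma integral_step_fun w (B : set (Rd R d)) : measurable B ->
  (forall i, 0 <= w i)%R ->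
  \int[lebesgue_Rd R d]_(x in B) (step_fun w x)%:E =
  \sum_i (w i)%:E * lebesgue_Rd R d (cell (enum_rank i) `&` B).
Proof.
move=> mB w0; under eq_integral do rewrite -sumEFin.
have mi i : measurable_fun B (fun x => (\1_(cell (enum_rank i)) x : R)%:E).
  apply/measurable_EFinP; apply: measurable_funTS.
  by apply: measurable_indic; exact: measurable_cell.
rewrite ge0_integral_sum//; last 2 first.
- by move=> i; under eq_fun do rewrite EFinM; exact: measurable_funeM.
- by move=> i x _; rewrite lee_fin mulr_ge0.
apply: eq_bigr => i _; under eq_integral do rewrite EFinM.
rewrite ge0_integralZl//; last by rewrite lee_fin.
by rewrite integral_indic//; exact: measurable_cell.
Qed.

Context (w : I -> R) (w_ge0 : forall i, (0 <= w i)%R).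
Context (w_sum : (\sum_i w i = 1)%R).

Lemma step_fun_ge0 x : (0 <= step_fun w x)%R.
Proof. by apply: sumr_ge0 => i _; rewrite mulr_ge0. Qed.

Lemma integral_step_funT : \int[lebesgue_Rd R d]_x (step_fun w x)%:E = 1.
Proof.
rewrite integral_step_fun//.
under eq_bigr do rewrite setIT lebesgue_cell mule1.
by rewrite sumEFin w_sum.
Qed.

(** Cells have volume 1, so a weight is both the mass of its cell and the value of the density
    there; in particular all values are at most 1. *)
Definition step_density : density R d :=
  Density (measurable_step_fun w) step_fun_ge0 integral_step_funT.

Lemma step_density_prob (d_gt0 : (0 < d)%N) J :
  density_prob step_density (cells J) = (\sum_(i in J) w i)%:E.
Proof.
rewrite /density_prob/= integral_step_fun//; last exact: measurable_cells.
rewrite -sumEFin [RHS]big_mkcond/=; apply: eq_bigr => i _.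
case: ifPn => iJ.
  rewrite setIidl ?lebesgue_cell ?mule1// => x ix.
  by exists i.
rewrite (_ : _ `&` _ = set0) ?measure0 ?mule0//.
apply/seteqP; split => // x [ix [j jJ jx]].
by move: iJ; rewrite (enum_rank_inj (val_inj (cell_inj d_gt0 ix jx))) jJ.
Qed.

Lemma step_density_le (A : R) : (1 <= A)%R -> bounded_density A step_density.
Proof.
move=> A1 x; apply: le_trans A1; rewrite -w_sum; apply: ler_sum => i _.
by rewrite indicE ler_piMr// lern1; case: (_ \in _).
Qed.

End cells.

Section cells_prob.
Context (R : realType) (d : nat) (d_gt0 : (0 < d)%N) (I : finType).

Lemma step_fun_le (w w' : I -> R) (c : R) (x : Rd R d) :
  (forall i, c * w i <= w' i)%R -> (c * step_fun w x <= step_fun w' x)%R.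
Proof.
move=> ww'; rewrite /step_fun mulr_sumr; apply: ler_sum => i _.
by rewrite mulrA ler_wpM2r.
Qed.

Lemma sum_cells_prob_le (h : density R d) :
  \sum_(i : I) density_prob h (cells [set i]%SET) <= 1.
Proof.
under eq_bigr do rewrite -(integral_indic_density _ (measurable_cells _)).
rewrite -ge0_integral_sum//; last 2 first.
- move=> i; exact: (measurable_int (lebesgue_Rd R d)
    (integrable_indic_density h (measurable_cells _))).
- by move=> i x _; rewrite lee_fin mulr_ge0// density_ge0.
rewrite -(integral_density h); apply: ge0_le_integral => //.
- by move=> x _; apply: sume_ge0 => i _; rewrite lee_fin mulr_ge0// density_ge0.
- apply: emeasurable_sum => i; exact: (measurable_int (lebesgue_Rd R d)
    (integrable_indic_density h (measurable_cells _))).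
- exact: measurable_EFin_density.
move=> x _; rewrite sumEFin lee_fin -mulr_suml ler_piMl ?density_ge0//.
have [[i _ ix]|nx] := pselect (exists2 i : I, True & cells [set i]%SET x).
  rewrite (bigD1 i)//= indicE mem_set// big1 ?addr0// => j ji.
  rewrite indicE memNset// => jx.
  have : (cells [set i]%SET `&` cells [set j]%SET) x by [].
  rewrite cells_setI// => k; rewrite !inE => /eqP ->.
  by rewrite eq_sym.
by rewrite big1// => i _; rewrite indicE memNset// => ix; apply: nx; exists i.
Qed.

Lemma sample_law_setT n (f : density R d) :
  sample_law n f [set: n.-tuple (Rd R d)] = 1.
Proof.
rewrite /sample_law (_ : [set: _] = [set t : n.-tuple (Rd R d) |
  forall i : 'I_n, [set: Rd R d] (tnth t i)]); last first.
  by apply/seteqP; split.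
rewrite (tuple_measure_box _ (A := fun=> setT))//; apply: big1 => i _.
exact: (probability_setT (density_prob f)).
Qed.

End cells_prob.

Lemma sum_mul_delta (R : nzRingType) (I : finType) (a : R) (x : I) :
  (\sum_i a * (i == x)%:R = a)%R.
Proof.
rewrite (bigD1 x)//= eqxx mulr1 big1 ?addr0// => i /negbTE ->.
by rewrite mulr0.
Qed.

(** Each counted index has [a i > (1 - a0) / c], while the [a i] sum to at most [1 - a0]. If
    [a0 = 1], all [a i] vanish and no index is counted. *)
Lemma card_scaled_gt1_le (R : realFieldType) (I : finType) (a : I -> R)
    (a0 c : R) : (0 < c)%R -> (forall i, 0 <= a i)%R ->
  (a0 + \sum_i a i <= 1)%R ->
  (#|[set i | 1 < c * a i + a0]%SET|%:R <= c)%R.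
Proof.
move=> c0 age0 a1; set J := finset _.
have s0 : (0 <= \sum_i a i)%R by exact: sumr_ge0.
have sJ : (\sum_(i in J) a i <= 1 - a0)%R.
  rewrite lerBrDl; apply: le_trans a1; rewrite lerD2l.
  by rewrite [leLHS]big_mkcond; apply: ler_sum => i _; case: ifP.
have : (#|J|%:R * (1 - a0) <= c * (1 - a0))%R.
  apply: (@le_trans _ _ (c * \sum_(i in J) a i)%R); last by rewrite ler_pM2l.
  rewrite mulr_sumr mulr_natl -sumr_const; apply: ler_sum => i.
  by rewrite inE; lra.
have [a01|] := ltP a0 1%R; first by rewrite ler_pM2r// subr_gt0.
move=> a0ge1 _.
have a00 i : a i = 0%R.
  have : (a i <= \sum_i a i)%R.
    by rewrite (bigD1 i)//= lerDl sumr_ge0.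
  have := age0 i; lra.
rewrite (_ : J = finset.set0) ?cards0 ?ltW//.
by apply/setP => i; rewrite !inE a00 mulr0 add0r; lra.
Qed.

(** * First bound: spikes *)

Lemma sum_option (R : nmodType) (I : finType) (F : option I -> R) :
  (\sum_i F i = F None + \sum_i F (Some i))%R.
Proof.
rewrite (bigD1 None)//=; congr (_ + _)%R.
rewrite (reindex_omap Some id) => [|[]//].
by apply: eq_bigl => i; rewrite eqxx.
Qed.

Section spiked_densities.
Context (R : realType) (d : nat) (d_gt0 : (0 < d)%N) (M B : nat).
Hypothesis B_gt0 : (0 < B)%N.
Variable eps : R.
Hypothesis eps01 : (0 <= eps <= 1)%R.

(** [None] stands for the common cell [C_0], and [Some (j, k)] for the spike cell [C_(j,k)]. *)
Let I : finType := option ('I_M * 'I_B).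
Implicit Types p : 'I_M * 'I_B.

Let eps0 : (0 <= eps)%R. Proof. by case/andP: eps01. Qed.
Let eps1 : (0 <= 1 - eps)%R. Proof. by rewrite subr_ge0; case/andP: eps01. Qed.

Definition base_weight (i : I) : R := ((1 : R) * (i == None)%:R)%R.

Definition spike_weight p (i : I) : R :=
  ((1 - eps) * (i == None)%:R + eps * (i == Some p)%:R)%R.

Definition group_weight (j : 'I_M) (i : I) : R :=
  ((1 - eps) * (i == None)%:R
   + \sum_(k < B) eps / B%:R * (i == Some (j, k))%:R)%R.

Let base_ge0 i : (0 <= base_weight i)%R.
Proof. by rewrite mulr_ge0. Qed.

Let base_sum : (\sum_i base_weight i = 1)%R.
Proof. exact: sum_mul_delta. Qed.

Let spike_ge0 p i : (0 <= spike_weight p i)%R.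
Proof. by rewrite addr_ge0// mulr_ge0. Qed.

Let spike_sum p : (\sum_i spike_weight p i = 1)%R.
Proof. by rewrite big_split/= !sum_mul_delta subrK. Qed.

Let group_ge0 j i : (0 <= group_weight j i)%R.
Proof.
by rewrite addr_ge0 ?mulr_ge0// sumr_ge0// => k _; rewrite mulr_ge0// divr_ge0.
Qed.

Let group_sum j : (\sum_i group_weight j i = 1)%R.
Proof.
rewrite big_split/= sum_mul_delta exchange_big/=.
under eq_bigr do rewrite sum_mul_delta.
rewrite sumr_const card_ord -[X in (_ + X)%R]mulr_natr divfK ?subrK//.
by rewrite pnatr_eq0 -lt0n.
Qed.

Definition base_density : density R d := step_density d base_ge0 base_sum.
Definition spike_density p : density R d :=
  step_density d (spike_ge0 p) (spike_sum p).
Definition group_density j : density R d :=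
  step_density d (group_ge0 j) (group_sum j).

(** The ratio of the densities is [B] on the spike, which has mass [eps], and at most 1
    elsewhere. *)
Lemma KL_spike_group p :
  KL (spike_density p) (group_density p.1) <= (eps * ln B%:R)%:E.
Proof.
have B1 : (1 <= B%:R :> R)%R by rewrite ler1n.
have -> : (eps * ln B%:R)%:E =
    (ln B%:R)%:E * density_prob (spike_density p) (cells [set Some p]%SET).
  rewrite step_density_prob// big_set1 /spike_weight/= eqxx mulr0 add0r mulr1.
  by rewrite -EFinM mulrC.
apply: KL_le => //; first exact: measurable_cells.
move=> x /=.
have [[i ix]|nx] := pselect (exists i : I, cell (enum_rank i) x); last first.
  rewrite !step_fun_out ?mulr0//; move=> [i _ ix]; apply: nx; exists i => //.
rewrite !(step_fun_in d_gt0 _ ix) /spike_weight /group_weight.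
have [xp|xp] := boolP (x \in _).
  have -> : i = Some p.
    move: xp; rewrite inE => -[i']; rewrite inE => /eqP -> px.
    exact/enum_rank_inj/val_inj/(cell_inj d_gt0 ix px).
  rewrite eqxx !mulr0 !add0r mulr1 (bigD1 p.2)//= -surjective_pairing eqxx.
  rewrite mulr1.
  rewrite mulrDr mulrCA mulfV ?pnatr_eq0 -?lt0n// mulr1 lerDl.
  rewrite mulr_ge0// sumr_ge0//.
  by move=> k _; rewrite mulr_ge0// divr_ge0.
have /negbTE -> : i != Some p.
  apply: contraNneq xp => ip; rewrite inE.
  by exists (Some p); rewrite ?inE// -ip.
rewrite mulr0 addr0 mul1r lerDl sumr_ge0// => k _.
by rewrite mulr_ge0// divr_ge0.
Qed.

Section estimator_loss.
Variables (n : nat) (fhat : estimator R d n) (c : R).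
Hypothesis c_gt0 : (0 < c)%R.

(** This is the condition under which the correction term in [KL_ge] is nonnegative, with [U] the
    spike cell and [V] the common cell. *)
Definition low_spike_mass p : set (n.-tuple (Rd R d)) :=
  [set x | c%:E * density_prob (fhat x) (cells [set Some p]%SET)
           + density_prob (fhat x) (cells [set None : I]%SET) <= 1].

Lemma measurable_low_spike_mass p : measurable (low_spike_mass p).
Proof.
rewrite -[low_spike_mass p]setTI; apply: emeasurable_fun_infty_c => //.
apply: emeasurable_funD; [apply: measurable_funeM|].
  by apply: measurable_estimate_prob; exact: measurable_cells.
by apply: measurable_estimate_prob; exact: measurable_cells.
Qed.

Lemma KL_spike_ge p x : low_spike_mass p x ->
  (eps * ln c)%:E <= KL (spike_density p) (fhat x).
Proof.
move=> px; pose U : set (Rd R d) := cells [set Some p]%SET.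
pose V : set (Rd R d) := cells [set None : I]%SET.
have mU : measurable U by exact: measurable_cells.
have mV : measurable V by exact: measurable_cells.
have UV : U `&` V = set0.
  by apply: cells_setI => // i; rewrite !inE => /eqP ->.
have pU : density_prob (spike_density p) U = eps%:E.
  rewrite step_density_prob// big_set1 /spike_weight/= eqxx mulr0 add0r.
  by rewrite mulr1.
have pV : density_prob (spike_density p) V = (1 - eps)%:E.
  by rewrite step_density_prob// big_set1 /spike_weight/= mulr0 addr0 mulr1.
have fUV : density_prob (spike_density p) (~` (U `|` V)) = 0.
  rewrite probability_setC; last exact: measurableU.
  rewrite (_ : _ (U `|` V) = eps%:E + (1 - eps)%:E); last first.
    by rewrite -pU -pV -measureU.
  by rewrite -EFinD; congr EFin; ring.
apply: le_trans (KL_ge (fhat x) mU mV UV c_gt0 fUV).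
rewrite [density_prob _ U]pU -EFinM mulrC -addeA leeDl// sube_ge0//.
by rewrite orbT.
Qed.

(** Averaging over [p]: for each sample at most [c] of the [M * B] spikes fail, so at least a
    quarter of the events hold. The law of samples inside the common cell is the same for all [p],
    hence some event has probability at least 1/4. *)
Lemma exists_low_spike_mass : (0 < M)%N -> (c <= 3 / 4 * (M * B)%:R)%R ->
  exists p, (4^-1)%:E <= sample_law n base_density (low_spike_mass p).
Proof.
move=> M0 cMB; apply: contrapT => /forallNP np.
set P := sample_law n base_density.
have Pfin p : P (low_spike_mass p) \is a fin_num.
  rewrite ge0_fin_numE//; apply: le_lt_trans (ltry 1).
  rewrite -(sample_law_setT n base_density).
  by apply: le_measure; rewrite ?inE//; exact: measurable_low_spike_mass.
have lt14 p : (fine (P (low_spike_mass p)) < 4^-1)%R.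
  by rewrite -lte_fin fineK// ltNge; apply/negP/np.
have : \int[P]_x (\sum_p (\1_(low_spike_mass p) x)%:E) =
    (\sum_p fine (P (low_spike_mass p)))%:E.
  rewrite ge0_integral_sum//; last first.
    move=> p; apply/measurable_EFinP/measurable_indic.
    exact: measurable_low_spike_mass.
  rewrite -sumEFin; apply: eq_bigr => p _.
  by rewrite fineK// integral_indic ?setIT//; exact: measurable_low_spike_mass.
have : ((M * B)%:R / 4)%:E <= \int[P]_x (\sum_p (\1_(low_spike_mass p) x)%:E).
  rewrite -[leLHS]mule1 -(sample_law_setT n base_density) -integral_cst//.
  apply: ge0_le_integral => //.
  - by move=> x _; rewrite lee_fin.
  - apply: emeasurable_sum => p; apply/measurable_EFinP/measurable_indic.
    exact: measurable_low_spike_mass.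
  move=> x _; rewrite sumEFin lee_fin.
  pose a (i : I) := fine (density_prob (fhat x) (cells [set i]%SET)).
  have aE i : density_prob (fhat x) (cells [set i]%SET) = (a i)%:E.
    by rewrite /a fineK// density_prob_fin_num//; exact: measurable_cells.
  have a0 i : (0 <= a i)%R by rewrite -lee_fin -aE.
  have asum : (a None + \sum_p a (Some p) <= 1)%R.
    have := sum_cells_prob_le d_gt0 I (fhat x).
    under eq_bigr do rewrite aE.
    by rewrite sumEFin lee_fin sum_option.
  have := card_scaled_gt1_le c_gt0 (fun p => a0 (Some p)) asum.
  set J := finset _ => Jc.
  have -> : (\sum_p \1_(low_spike_mass p) x = #|~: J|%SET%:R :> R)%R.
    rewrite -sum1_card natr_sum [RHS]big_mkcond/=; apply: eq_bigr => p _.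
    rewrite indicE !inE -leNgt.
    rewrite (_ : (x \in _) = (c * a (Some p) + a None <= 1)%R).
      by case: ifP.
    by apply/idP/idP; rewrite inE /low_spike_mass/= !aE -EFinM -EFinD lee_fin.
  rewrite cardsCs finset.setCK natrB ?max_card// card_prod !card_ord.
  by lra.
move=> + E; rewrite E lee_fin leNgt => /negP; apply.
apply: (@lt_le_trans _ _ (\sum_(p : 'I_M * 'I_B) 4^-1)%R).
  apply: ltr_sum => //; apply/hasP.
  exists (Ordinal M0, Ordinal B_gt0) => //.
by rewrite sumr_const card_prod !card_ord mulr_natl.
Qed.

(** Since the spiked density is at least [1 - eps] times the base density, passing from the base law
    to the spiked law costs the factor [(1 - eps) ^+ n]. *)
Lemma exists_spike_loss_ge (q : R) : (0 < q)%R -> (1 <= c)%R ->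
  (0 < M)%N -> (c <= 3 / 4 * (M * B)%:R)%R ->
  exists p, ((eps * ln c) `^ q * ((1 - eps) ^+ n / 4))%:E <=
    \int[sample_law n (spike_density p)]_x (KL (spike_density p) (fhat x) `^ q).
Proof.
move=> q0 c1 M0 cMB; have [p Pp] := exists_low_spike_mass M0 cMB.
have lnc0 : (0 <= eps * ln c)%R by rewrite mulr_ge0// ln_ge0.
exists p; apply: le_trans _ (ge0_cst_le_integral (v := (eps * ln c) `^ q) _
  (measurable_low_spike_mass p) _ _ _) => //.
- rewrite EFinM lee_wpmul2l ?lee_fin ?powR_ge0//.
  rewrite EFinM.
  apply: le_trans _ (tuple_measure_le (mu := density_prob base_density)
    (D := setT) (c := (1 - eps)%R) _ _ _ _ _) => //.
  + by rewrite lee_wpmul2l// lee_fin exprn_ge0.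
  + move=> D mD _; apply: density_prob_le => // x _ /=.
    apply: step_fun_le => i; rewrite /base_weight /spike_weight mul1r lerDl.
    by rewrite mulr_ge0.
  + exact: measurable_low_spike_mass.
- by rewrite powR_ge0.
- by move=> x; exact: poweR_ge0.
move=> x px; rewrite -poweR_EFin.
apply: gt0_ler_poweR; first exact: ltW.
- by rewrite in_itv/= lee_fin lnc0 leey.
- by rewrite in_itv/= KL_ge0 leey.
exact: KL_spike_ge.
Qed.

End estimator_loss.
End spiked_densities.

(** * Choice of the parameters in the first bound *)

Lemma bernoulli_ineq (R : realDomainType) (x : R) (n : nat) :
  (0 <= x <= 1 -> 1 - n%:R * x <= (1 - x) ^+ n)%R.
Proof.
move=> /andP[x0 x1]; elim: n => [|n IH]; first by rewrite expr0 mul0r subr0.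
rewrite exprS -subr_ge0; rewrite -subr_ge0 in IH.
have : (0 <= (1 - x) * ((1 - x) ^+ n - (1 - n%:R * x)) + n%:R * x ^+ 2)%R.
  by rewrite addr_ge0// mulr_ge0// ?subr_ge0// exprn_ge0.
move=> h; apply: le_trans h _; rewrite le_eqVlt; apply/orP; left; apply/eqP.
by rewrite -natr1; ring.
Qed.

(** Here [L] is [log M / n] and [B = M ^ m]. The factor [2^-1 / 4] combines [(1 - eps) ^+ n >= 1/2]
    with the probability 1/4, and the subtracted term is the benchmark. *)
Lemma spike_loss_numeric (R : realType) (L q : R) : (0 <= L)%R -> (0 < q)%R ->
  exists m : nat, (4^-1 ^+ 16 / 8 * L `^ q <=
    (L / 2 * (m%:R + 2^-1)) `^ q * (2^-1 / 4) - (L / 2 * m%:R) `^ q)%R.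
Proof.
move=> L0 q0.
have Lq0 : (0 <= L `^ q)%R by exact: powR_ge0.
(* For [q >= 16], [(5 / 4)]^ q[is at least 16; after division by 8 the loss is twice the benchmark]L
   [^ q]. *)
have [q16|q16] := leP 16%:R q.
  exists 2%N.
  rewrite (_ : L / 2 * (2%:R + 2^-1) = L * (5 / 4))%R; last by field.
  rewrite (_ : L / 2 * 2%:R = L)%R; last by field.
  rewrite powRM ?divr_ge0//.
  have h : (16 <= (5 / 4) `^ q)%R.
    apply: le_trans (ler_powR _ q16); last by lra.
    rewrite powR_mulrn ?divr_ge0//.
    by rewrite !exprS expr0; lra.
  have : (0 <= L `^ q * ((5 / 4) `^ q - 16))%R by rewrite mulr_ge0// subr_ge0.
  have : (4^-1 ^+ 16 / 8 * L `^ q <= L `^ q)%R.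
    apply: ler_piMl => //.
    have : (4^-1 ^+ 16 <= 1 :> R)%R by apply: exprn_ile1; lra.
    by lra.
  by lra.
(* With [m = 0] the benchmark is zero, and [q < 16] gives the constant [4^-1 ^+ 16]. *)
exists 0%N.
rewrite mulr0 powR0 ?gt_eqF// subr0 add0r.
rewrite (_ : L / 2 * 2^-1 = 4^-1 * L)%R; last by field.
rewrite powRM ?invr_ge0//.
have h : (4^-1 ^+ 16 <= 4^-1 `^ q :> R)%R.
  rewrite -powR_mulrn//; apply: ger_powR; last exact: ltW.
  by apply/andP; split; lra.
have : (0 <= (4^-1 `^ q - 4^-1 ^+ 16) * L `^ q :> R)%R.
  by rewrite mulr_ge0// subr_ge0.
by lra.
Qed.

Section direct_divergence.
Context (R : realType) (d : nat) (d_gt0 : (0 < d)%N) (M n : nat).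
Hypotheses (M_ge2 : (2 <= M)%N) (n_gt0 : (0 < n)%N).
Variables (A q : R).
Hypotheses (A_ge1 : (1 <= A)%R) (q_gt0 : (0 < q)%R).

Lemma direct_KL_lower_bound :
  (4^-1 ^+ 16 / 8 * (ln M%:R / n%:R) `^ q)%:E <=
    ereal_sup [set
      ereal_inf [set
        ereal_sup [set
          (\int[sample_law n f]_x (KL f (fhat x) `^ q))
            - \big[Order.min/+oo]_(j < M) (KL f (fs j) `^ q)
        | f in bounded_density A]
      | fhat in [set: estimator R d n]]
    | fs in [set fs : 'I_M -> density R d | forall j, bounded_density A (fs j)]].
Proof.
set L := (ln M%:R / n%:R)%R.
have M1 : (1 <= M%:R :> R)%R by rewrite ler1n ltnW.
have M0 : (0 < M%:R :> R)%R by exact: lt_le_trans ltr01 M1.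
have n1 : (1 <= n%:R :> R)%R by rewrite ler1n.
have n0 : (0 < n%:R :> R)%R by exact: lt_le_trans ltr01 n1.
have L0 : (0 <= L)%R by rewrite divr_ge0// ln_ge0.
have [m Lm] := spike_loss_numeric L0 q_gt0.
pose B := (M ^ m)%N.
have B0 : (0 < B)%N by rewrite expn_gt0 ltnW.
(* With this value Bernoulli's inequality gives [(1 - eps) ^+ n >= 1/2]. *)
pose eps := ((2 * n%:R)^-1 : R)%R.
have eps01 : (0 <= eps <= 1)%R.
  by rewrite invr_ge0 mulr_ge0//= invf_le1 ?mulr_gt0//; lra.
have lnB : (eps * ln B%:R = L / 2 * m%:R)%R.
  rewrite /B natrX lnXn// /eps /L -mulr_natr; field.
  by rewrite gt_eqF.
(* A value between [B], which governs the benchmark, and the number [M * B] of spikes: the loss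
   gains [eps * ln M / 2] over the benchmark, and at most three quarters of the spikes fail because
   [sqrt 2 >= 4/3]. *)
pose c := (B%:R * Num.sqrt M%:R : R)%R.
have sM0 : (0 < Num.sqrt M%:R :> R)%R by rewrite sqrtr_gt0.
have lnc : (eps * ln c = L / 2 * (m%:R + 2^-1))%R.
  rewrite lnM ?posrE ?ltr0n// -powR12_sqrt ?ltW// ln_powR mulrDr lnB.
  rewrite /eps /L; field.
  by rewrite gt_eqF.
have sM1 : (1 <= Num.sqrt M%:R :> R)%R by rewrite -[leLHS]sqrtr1 ler_wsqrtr.
have B1 : (1 <= B%:R :> R)%R by rewrite ler1n.
have c1 : (1 <= c)%R by rewrite mulr_ege1.
have cMB : (c <= 3 / 4 * (M * B)%:R)%R.
  rewrite natrM.
  rewrite (_ : 3 / 4 * (M%:R * B%:R) = B%:R * (3 / 4 * M%:R))%R; last by ring.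
  rewrite ler_wpM2l//.
  have := sqr_sqrtr (ltW M0).
  have : (2 <= M%:R :> R)%R by rewrite ler_nat.
  set s := Num.sqrt _ => M2 s2; rewrite -s2 in M2 *.
  have : (4 / 3 <= s)%R.
    rewrite leNgt; apply/negP => s43.
    have : (s ^+ 2 < (4 / 3) ^+ 2)%R by rewrite !expr2 ltr_pM// ltW.
    by lra.
  by nra.
have e2 : (2^-1 <= (1 - eps) ^+ n)%R.
  apply: le_trans (bernoulli_ineq n eps01).
  rewrite /eps le_eqVlt; apply/orP; left; apply/eqP; field.
  by rewrite gt_eqF.
apply: le_ereal_sup_tmp; eexists.
  exists (fun j => group_density d B0 eps01 j) => // j.
  exact: step_density_le.
apply/ereal_infP => _ [fhat _ <-].
have [p Ep] := exists_spike_loss_ge d_gt0 B0 eps01 fhat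
  (lt_le_trans ltr01 c1) q_gt0 c1 (ltnW M_ge2) cMB.
apply: le_ereal_sup_tmp; eexists.
  by exists (spike_density d eps01 p) => //; exact: step_density_le.
apply: (@le_trans _ _ (((eps * ln c) `^ q * ((1 - eps) ^+ n / 4))%:E
    - ((eps * ln B%:R) `^ q)%:E)).
  rewrite -EFinB lee_fin lnc lnB; apply: le_trans Lm _.
  rewrite lerD2r ler_wpM2l ?powR_ge0//.
  by rewrite ler_pM2r// invr_gt0.
apply: leeB => //.
apply: le_trans (bigmin_le _ p.1 _) _.
rewrite -poweR_EFin; apply: gt0_ler_poweR; first exact: ltW.
- by rewrite in_itv/= KL_ge0 leey.
- rewrite in_itv/= lee_fin lnB ?leey ?andbT.
  by apply: mulr_ge0 => //; exact: divr_ge0.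
exact: KL_spike_group.
Qed.
End direct_divergence.

(** * Second bound: hidden supports *)

Section hidden_support.
Context (R : realType) (d : nat) (d_gt0 : (0 < d)%N) (N : nat).

(** [inl b] stands for the cell [D_b], and the [inr k] for the [N] cells among which the support is
    hidden. *)
Let I : finType := (bool + 'I_N)%type.
Implicit Types (T : {set 'I_N}) (b : bool).

Definition model_weight b (i : I) : R := ((1 : R) * (i == inl b)%:R)%R.

Definition hidden_weight T b (i : I) : R :=
  match i with
  | inl b' => 2^-1 * (b' == b)%:R
  | inr k => if k \in T then (2 * #|T|%:R)^-1 else 0
  end%R.

Definition hidden_part T : {set I} := [set inr k | k in T]%SET.

Let model_ge0 b i : (0 <= model_weight b i)%R.
Proof. by rewrite mulr_ge0. Qed.

Let model_sum b : (\sum_i model_weight b i = 1)%R.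
Proof. exact: sum_mul_delta. Qed.

Let hidden_ge0 T b i : (0 <= hidden_weight T b i)%R.
Proof. by case: i => [b'|k] /=; [rewrite mulr_ge0|case: ifP]. Qed.

Let hidden_sum T b : (0 < #|T|)%N -> (\sum_i hidden_weight T b i = 1)%R.
Proof.
move=> T0; rewrite big_sumType/= sum_mul_delta -big_mkcond/= sumr_const.
rewrite -[X in (_ + X)%R]mulr_natr invfM -mulrA mulVf ?pnatr_eq0 -?lt0n//.
by rewrite mulr1; lra.
Qed.

Definition model_density b : density R d :=
  step_density d (model_ge0 b) (model_sum b).
Definition hidden_density T b (T0 : (0 < #|T|)%N) : density R d :=
  step_density d (hidden_ge0 T b) (hidden_sum b T0).

(** The ratio of the densities is 2 on [D_b], and the model density vanishes elsewhere. *)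
Lemma KL_model_hidden T b (T0 : (0 < #|T|)%N) :
  KL (model_density b) (hidden_density b T0) <= (ln 2)%:E.
Proof.
have -> : (ln 2)%:E =
    (ln 2)%:E * density_prob (model_density b) (cells [set (inl b : I)]%SET).
  by rewrite step_density_prob// big_set1 /model_weight eqxx mulr1 mule1.
apply: KL_le => [||x /=]; [exact: measurable_cells|by rewrite ler1n|].
have [[i ix]|nx] := pselect (exists i : I, cell (enum_rank i) x); last first.
  by rewrite !step_fun_out ?mulr0//; move=> [i _ ix]; apply: nx; exists i.
rewrite !(step_fun_in d_gt0 _ ix) /model_weight.
have [ib|ib] := eqVneq i (inl b : I); last first.
  by rewrite mulr0 mulr_ge0//; case: ifP.
rewrite ib mem_set; last by exists (inl b); rewrite ?inE// -ib.
by rewrite /= eqxx !mulr1 mulfV.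
Qed.

Lemma hidden_density_prob T' b (T0 : (0 < #|[set: 'I_N]%SET|)%N) :
  density_prob (hidden_density b T0) (cells (hidden_part T')) =
  (#|T'|%:R / (2 * N%:R))%:E.
Proof.
rewrite step_density_prob// big_imset/=; last by move=> i j _ _ [].
rewrite (eq_bigr (fun=> (2 * N%:R)^-1)%R) => [|k _]; last first.
  by rewrite finset.in_setT cardsT card_ord.
by congr EFin; rewrite sumr_const -[LHS]mulr_natl.
Qed.

Section estimator_loss.
Variables (n : nat) (fhat : estimator R d n).

(** On this event the loss under [hidden_density] of [T] and [b] is infinite, by lack of absolute
    continuity. Keeping the sample inside [T] allows the event to be compared under the laws for
    different supports. *)
Definition escaping T b : set (n.-tuple (Rd R d)) :=
  [set x | forall i, cells (hidden_part T) (tnth x i)] `&`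
  [set x | 0 < density_prob (fhat x) (~` cells (inl b |: hidden_part T)%SET)].

Lemma measurable_escaping T b : measurable (escaping T b).
Proof.
apply: measurableI.
  apply: (measurable_tuple_box (A := fun=> cells (hidden_part T))) => _.
  exact: measurable_cells.
rewrite -[X in measurable X]setTI; apply: emeasurable_fun_o_infty => //.
by apply: measurable_estimate_prob; apply: measurableC; exact: measurable_cells.
Qed.

Lemma KL_escaping T b (T0 : (0 < #|T|)%N) x : escaping T b x ->
  KL (fhat x) (hidden_density b T0) = +oo.
Proof.
move=> [_ /= xpos]; rewrite /KL.
case: ifPn => // /asboolP/null_content_dominatesP.
move=> /(_ (~` cells (inl b |: hidden_part T)%SET)) fx0.
move: xpos; rewrite fx0 ?ltxx//.
  by apply: measurableC; exact: measurable_cells.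
apply: integral0_eq => y /= ny; congr EFin.
have [[i iy]|niy] := pselect (exists i : I, cell (enum_rank i) y); last first.
  by apply: step_fun_out => -[i _ iy]; apply: niy; exists i.
rewrite (step_fun_in d_gt0 _ iy).
have : i \notin (inl b |: hidden_part T)%SET.
  by apply/negP => iT; apply: ny; exists i.
rewrite in_setU1 negb_or => /andP[]; case: i {iy} => [b'|k] ib iT /=.
  by rewrite (_ : b' == b = false) ?mulr0//; apply/negbTE.
by rewrite ifN//; apply: contra iT => kT; apply/imsetP; exists k.
Qed.

Lemma integral_KL_escaping (q : R) T b (T0 : (0 < #|T|)%N) : (0 < q)%R ->
  0 < sample_law n (hidden_density b T0) (escaping T b) ->
  \int[sample_law n (hidden_density b T0)]_x
    (KL (fhat x) (hidden_density b T0) `^ q) = +oo.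
Proof.
move=> q0 Z0; apply: (ge0_integral_eq_pinfty (measurable_escaping T b)) => //.
  by move=> x; exact: poweR_ge0.
by move=> x xZ; rewrite KL_escaping// poweRyr// gt_eqF.
Qed.

Hypothesis n_gt0 : (0 < n)%N.
Variable T0 : (0 < #|[set: 'I_N]%SET|)%N.
Let fstar := hidden_density true T0.

(** The complementary case to [integral_KL_escaping], where some risk is already infinite. *)
Hypothesis not_escaping : forall T b (T1 : (0 < #|T|)%N),
  sample_law n (hidden_density b T1) (escaping T b) = 0.

Let N_gt0 : (0 < N)%N.
Proof. by move: T0; rewrite cardsT card_ord. Qed.

(** The support used below depends on the sample, so the events of all the finitely many pairs
    [(T, b)] are discarded together. *)
Let escape : set (n.-tuple (Rd R d)) :=
  \big[setU/set0]_(Tb : {set 'I_N} * bool | (0 < #|Tb.1|)%N)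
    escaping Tb.1 Tb.2.

Let confined : set (n.-tuple (Rd R d)) :=
  [set x | forall i, cells (hidden_part [set: 'I_N]%SET) (tnth x i)] `\` escape.

Let measurable_hidden_box :
  measurable [set x : n.-tuple (Rd R d) |
    forall i, cells (hidden_part [set: 'I_N]%SET) (tnth x i)].
Proof.
apply: (measurable_tuple_box
  (A := fun=> cells (hidden_part [set: 'I_N]%SET))) => _.
exact: measurable_cells.
Qed.

(** On the cells of [T] the density [fstar] equals [1 / (2N)], at most the value [1 / (2 #|T|)] of
    the density hidden in [T]. Null events with samples inside [T] are therefore null for [fstar]
    too, for either [b]. *)
Let escape_null : measurable escape /\ sample_law n fstar escape = 0.
Proof.
rewrite /escape; elim/big_ind: _ => [|X Y [mX X0] [mY Y0]|[T b] /= T1].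
- by rewrite measure0.
- split; first exact: measurableU.
  apply/eqP; rewrite -measure_le0; apply: le_trans (measureU2 _ mX mY) _.
  by rewrite [X in X + _]X0 [X in _ + X]Y0 adde0.
split; first exact: measurable_escaping.
apply/eqP; rewrite -measure_le0 -(not_escaping b T1).
rewrite -[leLHS]mul1e -(expr1n R n).
apply: (tuple_measure_le (mu := density_prob fstar)
    (nu := density_prob (hidden_density b T1))
    (D := cells (hidden_part T))) => //.
- exact: measurable_cells.
- move=> D mD DT; apply: density_prob_le => // x Dx /=.
  have [i + ix] := DT _ Dx; move=> /imsetP[k kT ik].
  rewrite !(step_fun_in d_gt0 _ ix) ik /= finset.in_setT kT mul1r.
  rewrite lef_pV2 ?posrE ?mulr_gt0 ?ltr0n//.
  by rewrite ler_pM2l// ler_nat subset_leq_card// finset.subsetT.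
- exact: measurable_escaping.
by move=> x [].
Qed.

Let measurable_confined : measurable confined.
Proof. by apply: measurableD => //; exact: escape_null.1. Qed.

(** The hidden cells have [fstar]-mass 1/2, so all [n] observations fall there with probability
    [2^-n]. *)
Let confined_prob : (2^-1 ^+ n)%:E <= sample_law n fstar confined.
Proof.
have [mE E0] := escape_null.
have -> : (2^-1 ^+ n)%:E = sample_law n fstar [set x : n.-tuple (Rd R d) |
    forall i, cells (hidden_part [set: 'I_N]%SET) (tnth x i)].
  rewrite /sample_law (tuple_measure_box _
    (A := fun=> cells (hidden_part [set: 'I_N]%SET))); last first.
    by move=> _; exact: measurable_cells.
  rewrite (eq_bigr (fun=> (2^-1 : R)%:E)).
    by rewrite prodEFin prodr_const card_ord.
  move=> i _; rewrite [LHS]hidden_density_prob cardsT card_ord invfM.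
  by rewrite mulrCA mulfV ?mulr1// pnatr_eq0 -lt0n.
rewrite -[leRHS]adde0 -E0; apply: le_trans (measureU2 _ measurable_confined mE).
apply: le_measure; rewrite ?inE//; first exact: measurableU.
by move=> x Wx; have [Ex|Ex] := pselect (escape x); [right|left].
Qed.

Let KL_confined x : confined x ->
  (ln (2 * N%:R / n%:R))%:E <= KL (fhat x) fstar.
Proof.
move=> [Wx nEx].
have n0 : (0 < n%:R :> R)%R by rewrite ltr0n.
have N0 : (0 < N%:R :> R)%R by rewrite ltr0n.
have /choice[k kP] : forall i : 'I_n, exists k : 'I_N,
    cell (enum_rank (inr k : I)) (tnth x i).
  by move=> i; have [_ /imsetP[k _ ->] kx] := Wx i; exists k.
pose T := [set k i | i in [set: 'I_n]]%SET.
have T1 : (0 < #|T|)%N.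
  apply/card_gt0P; exists (k (Ordinal n_gt0)).
  by apply/imsetP; exists (Ordinal n_gt0).
have Tn : (#|T| <= n)%N.
  by rewrite (leq_trans (leq_imset_card _ _))// cardsT card_ord.
have xT i : cells (hidden_part T) (tnth x i).
  exists (inr (k i)); last exact: kP.
  by apply/imsetP; exists (k i) => //; apply/imsetP; exists i.
have hT b : density_prob (fhat x) (~` cells (inl b |: hidden_part T)%SET) = 0.
  apply/eqP; rewrite -measure_le0 leNgt; apply/negP => xb; apply: nEx.
  rewrite /escape (bigD1 (T, b))//=; left; split => //.
pose U : set (Rd R d) := cells (hidden_part T).
have mU : measurable U by exact: measurable_cells.
have mS b : measurable (~` cells (inl b |: hidden_part T)%SET : set (Rd R d)).
  by apply: measurableC; exact: measurable_cells.
(* The estimator has no mass outside [D_b] and [T], for both values of [b]; as the two [D_b] are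
   disjoint, it has none outside [T]. *)
have hU : density_prob (fhat x) (~` U) = 0.
  apply/eqP; rewrite -measure_le0.
  have := measureU2 (density_prob (fhat x)) (mS true) (mS false).
  rewrite [X in X + _]hT [X in _ + X]hT adde0; apply: le_trans.
  apply: le_measure; rewrite ?inE//; [exact: measurableC|exact: measurableU|].
  move=> y nUy; apply: contrapT.
  move=> /not_orP[/contrapT[i iT iy] /contrapT[j jT jy]].
  have ij : i = j by apply/enum_rank_inj/val_inj/(cell_inj d_gt0 iy jy).
  apply: nUy; exists i => //; move: iT jT; rewrite -ij !inE.
  by case/orP => // /eqP -> /orP[/eqP|].
(* At most [n] cells were observed, so [2N / n] times the [fstar]-mass of [U] is at most 1 and the
   correction term in [KL_ge] is nonnegative. *)
have c0 : (0 < 2 * N%:R / n%:R :> R)%R by rewrite divr_gt0// mulr_gt0.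
have := @KL_ge _ _ (fhat x) fstar U set0 _ mU measurable0 (setI0 _) c0.
rewrite setU0 => /(_ hU); apply: le_trans.
have -> : density_prob (fhat x) U = 1.
  have := probability_setC (density_prob (fhat x)) (measurableC mU).
  by rewrite setCK => ->; rewrite [X in _ - X]hU sube0.
rewrite [density_prob fstar U]hidden_density_prob measure0 adde0 mule1.
rewrite -EFinM -EFinD lee_fin -addrA lerDl subr_ge0.
rewrite [leLHS](_ : _ = #|T|%:R / n%:R)%R; last by field; rewrite !gt_eqF.
by rewrite ler_pdivrMr// mul1r ler_nat.
Qed.

Lemma hidden_loss_ge (q : R) : (0 < q)%R -> (n <= 2 * N)%N ->
  (ln (2 * N%:R / n%:R) `^ q * 2^-1 ^+ n)%:E <=
  \int[sample_law n fstar]_x (KL (fhat x) fstar `^ q).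
Proof.
move=> q0 nN.
have ln0 : (0 <= ln (2 * N%:R / n%:R) :> R)%R.
  by rewrite ln_ge0// ler_pdivlMr ?ltr0n// mul1r -natrM ler_nat.
apply: le_trans _ (ge0_cst_le_integral
  (v := (ln (2 * N%:R / n%:R) `^ q)%R) _ measurable_confined _ _ _).
- by rewrite EFinM lee_wpmul2l// lee_fin powR_ge0.
- by rewrite powR_ge0.
- by move=> x; exact: poweR_ge0.
move=> x xc; rewrite -poweR_EFin; apply: gt0_ler_poweR; first exact: ltW.
- by rewrite in_itv/= lee_fin ln0 ?leey.
- by rewrite in_itv/= KL_ge0 leey.
exact: KL_confined.
Qed.

End estimator_loss.
End hidden_support.

(** * The second supremum is infinite *)

Lemma ln_powR_unbounded (R : realType) (n : nat) (q a : R) :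
  (0 < n)%N -> (0 < q)%R ->
  exists2 N, (n <= N)%N & (a <= ln (2 * N%:R / n%:R) `^ q * 2^-1 ^+ n)%R.
Proof.
move=> n0 q0; have n0' : (0 < n%:R :> R)%R by rewrite ltr0n.
pose y := (2 ^+ n * `|a|)%R; pose z := (y `^ q^-1)%R.
have z0 : (0 <= z)%R by exact: powR_ge0.
pose N := (n * (Num.truncn (expR z)).+1)%N.
exists N; first by rewrite leq_pmulr.
have zN : (z <= ln (2 * N%:R / n%:R))%R.
  rewrite -[leLHS]expRK ler_ln ?posrE ?expR_gt0//; last first.
    by rewrite divr_gt0// mulr_gt0// ltr0n muln_gt0 n0.
  rewrite natrM mulrCA mulrAC mulfV ?gt_eqF// mul1r.
  have := truncnS_gt (expR z); have := expR_ge0 z; lra.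
have yz : (y <= ln (2 * N%:R / n%:R) `^ q)%R.
  have <- : (z `^ q = y)%R.
    by rewrite -powRrM mulVf ?gt_eqF// powRr1// mulr_ge0// exprn_ge0.
  apply: ge0_ler_powR; rewrite ?nnegrE//; first exact: ltW.
  exact: le_trans zN.
apply: (@le_trans _ _ (y * 2^-1 ^+ n)%R); last by rewrite ler_wpM2r// exprn_ge0.
by rewrite /y mulrAC -exprMn mulfV// expr1n mul1r ler_norm.
Qed.

Lemma reverse_KL_unbounded (R : realType) (d : nat) (d_gt0 : (0 < d)%N)
    (M n : nat) (M_ge2 : (2 <= M)%N) (n_gt0 : (0 < n)%N) (A q : R)
    (A_ge1 : (1 <= A)%R) (q_gt0 : (0 < q)%R) (a : R) :
  a%:E <=
    ereal_sup [set
      ereal_inf [set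
        ereal_sup [set
          (\int[sample_law n f]_x (KL (fhat x) f `^ q))
            - \big[Order.min/+oo]_(j < M) (KL (fs j) f `^ q)
        | f in bounded_density A]
      | fhat in [set: estimator R d n]]
    | fs in [set fs : 'I_M -> density R d | forall j, bounded_density A (fs j)]].
Proof.
(* [l] bounds the benchmark; [N] is then taken large enough for the risk to reach [a + l]. *)
pose l := (ln 2 `^ q : R)%R.
have [N nN Na] := ln_powR_unbounded (a + l) n_gt0 q_gt0.
have T0 : (0 < #|[set: 'I_N]%SET|)%N.
  by rewrite cardsT card_ord (leq_trans n_gt0).
(* Index 0 carries one model and all other indices the second one; both occur since [M >= 2]. *)
pose fs (j : 'I_M) := model_density R d N (val j == 0)%N.
apply: le_ereal_sup_tmp; eexists.
  by exists fs => // j; exact: step_density_le.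
apply/ereal_infP => _ [fhat _ <-].
have minl (T : {set 'I_N}) b (T1 : (0 < #|T|)%N) :
    \big[Order.min/+oo]_(j < M) (KL (fs j) (hidden_density R d b T1) `^ q)
    <= l%:E.
  have [j jb] : exists j : 'I_M, (val j == 0)%N = b.
    by case: b; [exists (Ordinal (ltnW M_ge2))|exists (Ordinal M_ge2)].
  apply: le_trans (bigmin_le _ j _) _; rewrite /fs jb.
  rewrite -poweR_EFin; apply: gt0_ler_poweR; first exact: ltW.
  - by rewrite in_itv/= KL_ge0 leey.
  - by rewrite in_itv/= lee_fin ln_ge0 ?leey// ler1n.
  exact: KL_model_hidden.
(* Either some hidden density already gives infinite risk, or the estimator is almost surely
   confined to the observed cells. *)
have [[T [b [T1 Z0]]]|nZ] := pselect
  (exists (T : {set 'I_N}) b (T1 : (0 < #|T|)%N),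
    0 < sample_law n (hidden_density R d b T1) (escaping fhat T b)).
  apply: le_ereal_sup_tmp; eexists.
    by exists (hidden_density R d b T1) => //; exact: step_density_le.
  rewrite integral_KL_escaping//.
  apply: (@le_trans _ _ (+oo - l%:E)); first by rewrite addye// leey.
  exact: leeB.
apply: le_ereal_sup_tmp; eexists.
  by exists (hidden_density R d true T0) => //; exact: step_density_le.
apply: (@le_trans _ _ ((a + l)%:E - l%:E)); first by rewrite -EFinB addrK.
apply: leeB => //.
apply: le_trans (hidden_loss_ge d_gt0 n_gt0 T0 _ q_gt0 _).
- by rewrite lee_fin.
- move=> T b T1; apply/eqP; rewrite -measure_le0 leNgt; apply/negP => Z0.
  by apply: nZ; exists T, b, T1.
- by rewrite (leq_trans nN)// leq_pmull.
Qed.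

(** * Both bounds with one constant *)

Unset Implicit Arguments.
Set Strict Implicit.

Theorem theorem3 (R : realType) (A : R) (A_gt1 : (1 < A)%R) :
  exists c : R, (0 < c)%R /\
  forall (d : nat) (d_gt0 : (0 < d)%N) (M : nat) (M_ge2 : (2 <= M)%N)
    (q : R) (q_gt0 : (0 < q)%R) (n : nat)
    (Mn : (ln M%:R <= 16 * (Num.min 1 (A - 1)) ^+ 2 * n%:R)%R),
  (c * (ln M%:R / n%:R) `^ q)%:E <=
    ereal_sup [set
      ereal_inf [set
        ereal_sup [set
          (\int[sample_law n f]_x (KL f (fhat x) `^ q))
            - \big[Order.min/+oo]_(j < M) (KL f (fs j) `^ q)
        | f in bounded_density A]
      | fhat in [set: estimator R d n]]
    | fs in [set fs : 'I_M -> density R d | forall j, bounded_density A (fs j)]]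
  /\
  (c * (ln M%:R / n%:R) `^ q)%:E <=
    ereal_sup [set
      ereal_inf [set
        ereal_sup [set
          (\int[sample_law n f]_x (KL (fhat x) f `^ q))
            - \big[Order.min/+oo]_(j < M) (KL (fs j) f `^ q)
        | f in bounded_density A]
      | fhat in [set: estimator R d n]]
    | fs in [set fs : 'I_M -> density R d | forall j, bounded_density A (fs j)]].
Proof.
exists (4^-1 ^+ 16 / 8)%R; split.
  by rewrite divr_gt0// exprn_gt0// invr_gt0.
move=> d d_gt0 M M_ge2 q q_gt0 n Mn.
(* For [n = 0] the hypothesis would read [ln M <= 0], which fails for [M >= 2]. *)
have n_gt0 : (0 < n)%N.
  rewrite lt0n; apply/eqP => n0; move: Mn; rewrite n0 mulr0 leNgt ln_gt0//.
  by rewrite ltr1n.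
split.
- exact: direct_KL_lower_bound (ltW A_gt1) q_gt0.
- exact: reverse_KL_unbounded (ltW A_gt1) q_gt0 _.
Qed.
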